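(* Let $B\otimes H$ be a trivial quantum principal fibre bundle ($B$ a unital algebra, $H$ a Hopf algebra with bijective antipode) with differential algebra $\Gamma(B)\hat\otimes\Gamma(H)$. (Left case) Let $D_l$ be the left covariant derivative of a left connection, so that $D_l(\gamma\otimes h)=d\gamma\,\hat\otimes\, h-(-1)^n\sum\gamma A_l(h_1)\hat\otimes h_2$ for $\gamma\in\Gamma^n(B)$, with $A_l:H\to\Gamma^1(B)$ linear, $A_l(1)=0$. Let $\alpha_l$ be a left gauge transformation on $B\otimes H$ with corresponding map $\tau_{\alpha_l}:H\to B$, and let $D_l'=\alpha_l\circ D_l\circ\alpha_l^{-1}$. Then $D_l'(a\otimes h)=da\,\hat\otimes\, h-\sum aA_l'(h_1)\hat\otimes h_2$ for $a\in B$, $h\in H$, with $$A_l'(h)=\sum\tau_{\alpha_l^{-1}}(h_1)A_l(h_2)\tau_{\alpha_l}(h_3)+\sum\tau_{\alpha_l^{-1}}(h_1)\,d\tau_{\alpha_l}(h_2).$$ (Right case) Let $D_r$ be the right covariant derivative of a right connection, so that $D_r(a\otimes h)=da\,\hat\otimes\,h-\sum A_r(h_1)a\,\hat\otimes\,h_2$ for $a\in B$, with $A_r:H\to\Gamma^1(B)$ linear, $A_r(1)=0$. Let $\alpha_r$ be a right gauge transformation with corresponding map $\tau_{\alpha_r}:H\to B$, and let $D_r'=\alpha_r\circ D_r\circ\alpha_r^{-1}$. Then $D_r'(a\otimes h)=da\,\hat\otimes\,h-\sum A_r'(h_1)a\,\hat\otimes\,h_2$ for $a\in B$, $h\in H$,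 with $$A_r'(h)=\sum\tau_{\alpha_r}(h_3)A_r(h_2)\tau_{\alpha_r^{-1}}(h_1)-\sum\tau_{\alpha_r}(h_2)\,d\tau_{\alpha_r^{-1}}(h_1).$$
   Context: Algebras are unital and associative over $\mathbb C$; Sweedler notation $\Delta(h)=\sum h_1\otimes h_2$. $\Gamma(B)$ is a differential graded algebra with $\Gamma^0(B)=B$ generated by $B$ and $dB$; $\Gamma(H)$ is a right covariant such algebra over $H$; $\hat\otimes$ is the graded tensor product. The horizontal forms are $\Gamma(B)\hat\otimes H$, and covariant derivatives are maps $\Gamma(B)\hat\otimes H\to\Gamma(B)\hat\otimes H$ of degree one. A left (right) gauge transformation on $B\otimes H$ is an isomorphism $\alpha$ of left (right) $(B\otimes1)$-modules with $(\alpha\otimes id)(id\otimes\Delta)=(id\otimes\Delta)\alpha$ and $\alpha(a\otimes1)=a\otimes1$. Left ones are exactly $\alpha_l(a\otimes h)=\sum a\tau_{\alpha_l}(h_1)\otimes h_2$ with $\tau_{\alpha_l}:H\to B$ linear, $\tau_{\alpha_l}(1)=1$, $\sum\tau_{\alpha_l^{-1}}(h_1)\tau_{\alpha_l}(h_2)=\sum\tau_{\alpha_l}(h_1)\tau_{\alpha_l^{-1}}(h_2)=\varepsilon(h)1$; right ones are exactly $\alpha_r(a\otimes h)=\sum\tau_{\alpha_r}(h_1)a\otimes h_2$ with $\tau_{\alpha_r}(1)=1$, $\sum\tau_{\alpha_r^{-1}}(h_2)\tau_{\alpha_r}(h_1)=\sum\tau_{\alpha_r}(h_2)\tau_{\alpha_r^{-1}}(h_1)=\varepsilon(h)1$.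 They act on horizontal forms by $\alpha_l(\gamma\hat\otimes h)=\sum\gamma\tau_{\alpha_l}(h_1)\hat\otimes h_2$ and $\alpha_r(\gamma\hat\otimes h)=\sum\tau_{\alpha_r}(h_1)\gamma\,\hat\otimes h_2$, $\gamma\in\Gamma(B)$. *)

(* Defs.v *)
From HB Require Import structures.
From mathcomp Require Import all_boot all_order all_algebra.
From mathcomp Require Import boolp reals.
From mathcomp Require Export complex.

Set Implicit Arguments.
Unset Strict Implicit.
Unset Printing Implicit Defensive.

Import GRing.Theory.
Local Open Scope ring_scope.
Local Open Scope quotient_scope.

Section Tensor.
Variable K : fieldType.

Definition bilin (V W X : lmodType K) (f : V -> W -> X) : Prop :=
  (forall w, linear (f^~ w)) /\ (forall v, linear (f v)).

Definition fsum (V W X : lmodType K) (f : V -> W -> X) (s : seq (V * W)) : X :=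
  \sum_(p <- s) f p.1 p.2.

Section Construction.
Variables V W : lmodType K.

(* A formal sum of pairs (v, w) stands for the sum of the v (x) w. Two formal
   sums are identified when no bilinear map separates them, which is the
   congruence generated by the bilinearity relations. *)
Definition tensor_rel (s t : seq (V * W)) : bool :=
  `[< forall (X : lmodType K) (f : V -> W -> X),
        bilin f -> fsum f s = fsum f t >].

Lemma tensor_rel_refl : reflexive tensor_rel.
Proof. by move=> s; apply/asboolP. Qed.

Lemma tensor_rel_sym : symmetric tensor_rel.
Proof.
by move=> s t; apply/asboolP/asboolP => st X f bf; rewrite (st X f bf).
Qed.

Lemma tensor_rel_trans : transitive tensor_rel.
Proof.
move=> t s u /asboolP st /asboolP tu; apply/asboolP => X f bf.
by rewrite (st X f bf) (tu X f bf).
Qed.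

Canonical tensor_equiv :=
  EquivRel tensor_rel tensor_rel_refl tensor_rel_sym tensor_rel_trans.

Definition tensor := {eq_quot tensor_equiv}.
HB.instance Definition _ := Choice.on tensor.
HB.instance Definition _ := EqQuotient.on tensor.

Definition tens (v : V) (w : W) : tensor := \pi_tensor [:: (v, w)].
Definition tensor0 : tensor := \pi_tensor [::].
Definition tensor_add (s t : tensor) : tensor := \pi_tensor (repr s ++ repr t).
Definition tensor_scale (k : K) (t : tensor) : tensor :=
  \pi_tensor [seq (k *: p.1, p.2) | p <- repr t].

(* The linear map induced by f; meaningful only when f is bilinear (otherwise
   the value depends on the chosen representative). *)
Definition tlift (X : lmodType K) (f : V -> W -> X) (t : tensor) : X :=
  fsum f (repr t).

Lemma tlift_pi (X : lmodType K) (f : V -> W -> X) s :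
  bilin f -> tlift f (\pi_tensor s) = fsum f s.
Proof.
by move=> bf; have /eqmodP/asboolP/(_ X f bf) := reprK (\pi_tensor s).
Qed.

Lemma tensor_ext (s t : tensor) :
  (forall (X : lmodType K) (f : V -> W -> X),
     bilin f -> tlift f s = tlift f t) -> s = t.
Proof.
move=> st; rewrite -[s]reprK -[t]reprK; apply/eqmodP/asboolP => X f bf.
exact: st.
Qed.

Lemma tlift_add (X : lmodType K) (f : V -> W -> X) s t :
  bilin f -> tlift f (tensor_add s t) = tlift f s + tlift f t.
Proof. by move=> bf; rewrite tlift_pi // /fsum big_cat. Qed.

Lemma tlift_scale (X : lmodType K) (f : V -> W -> X) k t :
  bilin f -> tlift f (tensor_scale k t) = k *: tlift f t.
Proof.
move=> bf; rewrite tlift_pi // /tlift /fsum big_map scaler_sumr.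
have f0 w : f 0 w = 0 by have := bf.1 w (-1) 0 0; rewrite scaler0 addr0 scaleN1r addNr.
apply: eq_bigr => p _ /=.
by have := bf.1 p.2 k p.1 0; rewrite addr0 f0 addr0.
Qed.

Lemma tlift0 (X : lmodType K) (f : V -> W -> X) :
  bilin f -> tlift f tensor0 = 0.
Proof. by move=> bf; rewrite tlift_pi // /fsum big_nil. Qed.

Lemma tensor_addA : associative tensor_add.
Proof. by move=> s t u; apply: tensor_ext => X f bf; rewrite !tlift_add // addrA. Qed.

Lemma tensor_addC : commutative tensor_add.
Proof. by move=> s t; apply: tensor_ext => X f bf; rewrite !tlift_add // addrC. Qed.

Lemma tensor_add0 : left_id tensor0 tensor_add.
Proof.
by move=> s; apply: tensor_ext => X f bf; rewrite tlift_add // tlift0 // add0r.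
Qed.

Lemma tensor_addN : left_inverse tensor0 (tensor_scale (-1)) tensor_add.
Proof.
move=> s; apply: tensor_ext => X f bf.
by rewrite tlift_add // tlift_scale // tlift0 // scaleN1r addNr.
Qed.

HB.instance Definition _ :=
  GRing.isZmodule.Build tensor tensor_addA tensor_addC tensor_add0 tensor_addN.

Lemma tensor_scaleA k l t :
  tensor_scale k (tensor_scale l t) = tensor_scale (k * l) t.
Proof. by apply: tensor_ext => X f bf; rewrite !tlift_scale // scalerA. Qed.

Lemma tensor_scale1 : left_id 1 tensor_scale.
Proof. by move=> t; apply: tensor_ext => X f bf; rewrite tlift_scale // scale1r. Qed.

Lemma tensor_scaleDr : right_distributive tensor_scale +%R.
Proof.
move=> k s t; apply: tensor_ext => X f bf.
by rewrite !(tlift_scale, tlift_add) // scalerDr.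
Qed.

Lemma tensor_scaleDl t : {morph tensor_scale^~ t : k l / k + l}.
Proof.
move=> k l; apply: tensor_ext => X f bf.
by rewrite !(tlift_scale, tlift_add) // scalerDl.
Qed.

HB.instance Definition _ :=
  GRing.Zmodule_isLmodule.Build K tensor
    tensor_scaleA tensor_scale1 tensor_scaleDr tensor_scaleDl.

Lemma tlift_linear (X : lmodType K) (f : V -> W -> X) :
  bilin f -> linear (tlift f).
Proof. by move=> bf k s t; rewrite tlift_add // tlift_scale. Qed.

Lemma tlift_tens (X : lmodType K) (f : V -> W -> X) v w :
  bilin f -> tlift f (tens v w) = f v w.
Proof. by move=> bf; rewrite tlift_pi // /fsum big_seq1. Qed.

Lemma tens_bilin : bilin tens.
Proof.
by split=> [w|v] k x y; apply: tensor_ext => X f bf;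
  rewrite tlift_linear // !tlift_tens //; [apply: bf.1 | apply: bf.2].
Qed.

Lemma tensor_sum (t : tensor) : t = \sum_(p <- repr t) tens p.1 p.2.
Proof.
apply: tensor_ext => X f bf; rewrite /tlift {1}/fsum.
rewrite -/(tlift f _); elim: (repr t) => [|p s IHs].
  by rewrite !big_nil tlift0.
by rewrite !big_cons tlift_add // tlift_tens // IHs.
Qed.

End Construction.
End Tensor.

Arguments tensor {K} V W.
Notation "v \ot w" := (tens v w) (at level 40, left associativity) : ring_scope.

Section Maps.
Variable K : fieldType.

Definition tmap (V W V' W' : lmodType K) (f : V -> V') (g : W -> W') :
    tensor V W -> tensor V' W' :=
  tlift (fun v w => f v \ot g w).

Definition tassoc (U V W : lmodType K) :
    tensor (tensor U V) W -> tensor U (tensor V W) :=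
  tlift (fun t w => tlift (fun u v => u \ot (v \ot w)) t).

Definition tassoc_inv (U V W : lmodType K) :
    tensor U (tensor V W) -> tensor (tensor U V) W :=
  tlift (fun u t => tlift (fun v w => (u \ot v) \ot w) t).

(* The (ungraded) product of the algebra A (x) A'. *)
Definition tmul (A A' : algType K) (x y : tensor A A') : tensor A A' :=
  tlift (fun a a' => tlift (fun b b' => (a * b) \ot (a' * b')) y) x.

End Maps.

Record hopfAlgebra (K : fieldType) := HopfAlgebra {
  hopf_alg :> algType K;
  comul : {linear hopf_alg -> tensor hopf_alg hopf_alg};
  counit : {linear hopf_alg -> K^o};
  antipode : {linear hopf_alg -> hopf_alg};
  comulA : forall h,
    tassoc (tmap comul id (comul h)) = tmap id comul (comul h);
  counitl : forall h, tlift (fun x y => counit x *: y) (comul h) = h;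
  counitr : forall h, tlift (fun x y => counit y *: x) (comul h) = h;
  comul1 : comul 1 = 1 \ot 1;
  comulM : forall g h, comul (g * h) = tmul (comul g) (comul h);
  counit1 : counit 1 = 1;
  counitM : forall g h, counit (g * h) = counit g * counit h;
  antipodel : forall h,
    tlift (fun x y => antipode x * y) (comul h) = (counit h)%:A;
  antipoder : forall h,
    tlift (fun x y => x * antipode y) (comul h) = (counit h)%:A
}.

(* Sweedler sums: sweedler2 h E is the sum of E h_1 h_2 and sweedler3 h E the
   sum of E h_1 h_2 h_3. E must be multilinear. *)
Section Sweedler.
Variables (K : fieldType) (H : hopfAlgebra K) (X : lmodType K).

Definition sweedler2 (h : H) (E : H -> H -> X) : X := tlift E (comul H h).

Definition sweedler3 (h : H) (E : H -> H -> H -> X) : X :=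
  sweedler2 h (fun x h3 => sweedler2 x (fun h1 h2 => E h1 h2 h3)).

End Sweedler.

(* A graded differential algebra generated in degree 0 and by d of degree 0,
   with degree-0 part identified with B through the injection incl. *)
Record diffAlgebra (K : fieldType) (B : algType K) := DiffAlgebra {
  forms :> algType K;
  form_deg : nat -> forms -> Prop;
  dform : {linear forms -> forms};
  incl : {lrmorphism B -> forms};
  form_deg_lin : forall n k x y,
    form_deg n x -> form_deg n y -> form_deg n (k *: x + y);
  form_deg_sum : forall x, exists m (y : 'I_m -> forms),
    (forall i : 'I_m, form_deg i (y i)) /\ x = \sum_i y i;
  form_deg_direct : forall m (y : 'I_m -> forms),
    (forall i : 'I_m, form_deg i (y i)) ->
    \sum_i y i = 0 -> forall i, y i = 0;
  form_degM : forall m n x y,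
    form_deg m x -> form_deg n y -> form_deg (m + n) (x * y);
  incl_inj : injective incl;
  form_deg0 : forall x, form_deg 0 x <-> exists b, x = incl b;
  dform_deg : forall n x, form_deg n x -> form_deg n.+1 (dform x);
  dformK : forall x, dform (dform x) = 0;
  dformM : forall n x y, form_deg n x ->
    dform (x * y) = dform x * y + (-1) ^+ n * (x * dform y);
  forms_generated : forall P : forms -> Prop,
    (forall b, P (incl b)) -> (forall b, P (dform (incl b))) ->
    (forall k x y, P x -> P y -> P (k *: x + y)) ->
    (forall x y, P x -> P y -> P (x * y)) ->
    forall x, P x
}.

Arguments form_deg {K B} G n x : rename.
Arguments dform {K B G} : rename.
Arguments incl {K B} G : rename.

(* The coproduct of H extends to an algebra map Gamma(H) -> Gamma(H) (x) H
   intertwining d and d (x) id. *)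
Definition right_covariant (K : fieldType) (H : hopfAlgebra K)
    (G : diffAlgebra H) : Prop :=
  exists rho : {linear G -> tensor G H},
    [/\ forall h, rho (incl G h) = tmap (incl G) id (comul H h),
        forall x y, rho (x * y) = tmul (rho x) (rho y)
      & forall x, rho (dform x) = tmap dform id (rho x)].

Section Gauge.
Variables (K : fieldType) (B : algType K) (H : hopfAlgebra K).

Definition right_colinear (alpha : tensor B H -> tensor B H) : Prop :=
  forall x, tmap alpha id (tassoc_inv (tmap id (comul H) x)) =
            tassoc_inv (tmap id (comul H) (alpha x)).

Definition left_gauge (alpha : {linear tensor B H -> tensor B H}) : Prop :=
  [/\ bijective alpha,
      forall b x, alpha (tmul (b \ot 1) x) = tmul (b \ot 1) (alpha x),
      right_colinear alpha
    & forall a, alpha (a \ot 1) = a \ot 1].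

Definition right_gauge (alpha : {linear tensor B H -> tensor B H}) : Prop :=
  [/\ bijective alpha,
      forall b x, alpha (tmul x (b \ot 1)) = tmul (alpha x) (b \ot 1),
      right_colinear alpha
    & forall a, alpha (a \ot 1) = a \ot 1].

Definition left_gauge_map (alpha : tensor B H -> tensor B H)
    (tau : {linear H -> B}) : Prop :=
  forall a h,
    alpha (a \ot h) = sweedler2 h (fun h1 h2 => (a * tau h1) \ot h2).

Definition right_gauge_map (alpha : tensor B H -> tensor B H)
    (tau : {linear H -> B}) : Prop :=
  forall a h,
    alpha (a \ot h) = sweedler2 h (fun h1 h2 => (tau h1 * a) \ot h2).

End Gauge.

Section Horizontal.
Variables (K : fieldType) (B : algType K) (H : hopfAlgebra K).
Variable GB : diffAlgebra B.

(* B (x) H sits inside the horizontal forms via incl GB. *)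
Definition hor := tensor GB H.

Definition hor_deg (n : nat) (x : hor) : Prop :=
  exists s : seq (GB * H),
    (forall p, p \in s -> form_deg GB n p.1) /\ x = \sum_(p <- s) p.1 \ot p.2.

(* The actions on horizontal forms of the left and right gauge transformations
   with corresponding map tau. *)
Definition left_gauge_hor (tau : {linear H -> B}) : hor -> hor :=
  tlift (fun g h => sweedler2 h (fun h1 h2 => (g * incl GB (tau h1)) \ot h2)).

Definition right_gauge_hor (tau : {linear H -> B}) : hor -> hor :=
  tlift (fun g h => sweedler2 h (fun h1 h2 => (incl GB (tau h1) * g) \ot h2)).

Definition degree_one (D : hor -> hor) : Prop :=
  forall n x, hor_deg n x -> hor_deg n.+1 (D x).

Definition gauge_potential (A : {linear H -> GB}) : Prop :=
  (forall h, form_deg GB 1 (A h)) /\ A 1 = 0.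

Definition left_cov_derivative (D : {linear hor -> hor})
    (A : {linear H -> GB}) : Prop :=
  [/\ degree_one D, gauge_potential A
    & forall n (g : GB) (h : H), form_deg GB n g ->
        D (g \ot h) =
          dform g \ot h
          - (-1) ^+ n *: sweedler2 h (fun h1 h2 => (g * A h1) \ot h2)].

Definition right_cov_derivative (D : {linear hor -> hor})
    (A : {linear H -> GB}) : Prop :=
  [/\ degree_one D, gauge_potential A
    & forall (a : B) (h : H),
        D (incl GB a \ot h) =
          dform (incl GB a) \ot h
          - sweedler2 h (fun h1 h2 => (A h1 * incl GB a) \ot h2)].

End Horizontal.

(* Main.v *)
From HB Require Import structures.
Require Import Defs.
From mathcomp Require Import all_boot all_order all_algebra.
From mathcomp Require Import reals.

Set Implicit Arguments.
Unset Strict Implicit.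
Unset Printing Implicit Defensive.

Import GRing.Theory.
Local Open Scope ring_scope.

(** For a linear map [f : H -> Gamma(B)] let [conv_act f] send [g (x) h] to
    [g f(h_1) (x) h_2]. By coassociativity [conv_act f' \o conv_act f] is
    [conv_act] of the convolution product [f * f']. A gauge transformation is
    [conv_act tau] and [D = d (x) id - conv_act A] in degree 0, so conjugation
    turns [A] into [tauV * A * tau - d tauV * tau]; the Leibniz rule applied to
    [tauV * tau = counit] rewrites the last term as [+ tauV * d tau]. The right
    case is the same computation for the opposite product of [Gamma(B)], because
    in degree 0 the Leibniz rule is symmetric under reversal of products. *)

(** * Unbundled linear maps and maps induced on tensor products *)

Section LinearLifts.
Variable K : fieldType.

Section LinearProp.
Variables (X Y : lmodType K) (g : X -> Y).
Hypothesis lg : linear g.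

(** Maps such as [conv_act f] or [fun v => v \ot w] come with a proof of [linear] only; packing them
    locally gives access to the lemmas on bundled linear maps. *)
Let g' : {linear X -> Y} := HB.pack g (GRing.isLinear.Build K X Y _ g lg).

Lemma linear_fun0 : g 0 = 0. Proof. exact: (raddf0 g'). Qed.

Lemma linear_funD x y : g (x + y) = g x + g y. Proof. exact: (raddfD g'). Qed.

Lemma linear_funB x y : g (x - y) = g x - g y. Proof. exact: (raddfB g'). Qed.

Lemma linear_funZ k x : g (k *: x) = k *: g x. Proof. exact: (linearZZ g'). Qed.

Lemma linear_fun_sum I (s : seq I) (F : I -> X) :
  g (\sum_(i <- s) F i) = \sum_(i <- s) g (F i).
Proof. exact: (raddf_sum g'). Qed.

End LinearProp.

Lemma linear_comp (X Y Z : lmodType K) (f : Y -> Z) (g : X -> Y) :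
  linear f -> linear g -> linear (fun x => f (g x)).
Proof. by move=> lf lg k x y; rewrite lg lf. Qed.

Lemma linear_add (X Y : lmodType K) (f g : X -> Y) :
  linear f -> linear g -> linear (fun x => f x + g x).
Proof. by move=> lf lg k x y; rewrite lf lg scalerDr addrACA. Qed.

Section Lifts.
Variables V W : lmodType K.
Implicit Type t : tensor V W.

Lemma tens_linearl w : linear (fun v : V => v \ot (w : W)).
Proof. exact: (tens_bilin V W).1. Qed.

Lemma tens_linearr v : linear (fun w : W => (v : V) \ot w).
Proof. exact: (tens_bilin V W).2. Qed.

Lemma eq_tlift (X : lmodType K) (f g : V -> W -> X) t :
  (forall v w, f v w = g v w) -> tlift f t = tlift g t.
Proof. by move=> fg; apply: eq_bigr => p _. Qed.

Lemma apply_tlift (X Y : lmodType K) (g : X -> Y) : linear g ->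
  forall (f : V -> W -> X) t, g (tlift f t) = tlift (fun v w => g (f v w)) t.
Proof. by move=> lg f t; apply: linear_fun_sum. Qed.

Lemma tliftD (X : lmodType K) (f g : V -> W -> X) t :
  tlift (fun v w => f v w + g v w) t = tlift f t + tlift g t.
Proof. exact: big_split. Qed.

Lemma tliftB (X : lmodType K) (f g : V -> W -> X) t :
  tlift (fun v w => f v w - g v w) t = tlift f t - tlift g t.
Proof. exact: sumrB. Qed.

Lemma linear_tliftl (Y X : lmodType K) (F : Y -> V -> W -> X) t :
  (forall v w, linear (fun y => F y v w)) -> linear (fun y => tlift (F y) t).
Proof.
move=> lF k x y; rewrite /tlift /fsum scaler_sumr -big_split /=.
by apply: eq_bigr => p _; rewrite lF.
Qed.

End Lifts.
End LinearLifts.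

(** Multilinearity makes [E] a linear map on [tensor H (tensor H H)]; applying that map to both
    sides of [comulA] gives the two sums. *)
Lemma sweedler_coassoc (K : fieldType) (H : hopfAlgebra K) (X : lmodType K)
    (E : H -> H -> H -> X) (h : H) :
  (forall v w, linear (fun u => E u v w)) ->
  (forall u w, linear (fun v => E u v w)) ->
  (forall u v, linear (E u v)) ->
  sweedler3 h E = sweedler2 h (fun u y => sweedler2 y (E u)).
Proof.
move=> l1 l2 l3.
have bE u : bilin (E u) by split=> [w|v]; [apply: l2 | apply: l3].
(* [tlift F] is the linear map induced by [E]. *)
pose F := fun u (t : tensor H H) => tlift (E u) t.
have bF : bilin F.
  by split=> [t|u]; [apply: linear_tliftl | apply: tlift_linear].
have b3 (w : H) : bilin (fun u v : H => u \ot (v \ot w)).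
  split=> [v|u]; first exact: tens_linearl.
  exact: linear_comp (tens_linearr _) (tens_linearl _).
have bA : bilin (fun (t : tensor H H) (w : H) =>
                   tlift (fun u v => u \ot (v \ot w)) t).
  split=> [w|t]; first exact: tlift_linear.
  apply: linear_tliftl => u v.
  exact: linear_comp (tens_linearr _) (tens_linearr _).
have lF := tlift_linear bF.
have := congr1 (tlift F) (comulA h); rewrite /tmap /tassoc.
rewrite (apply_tlift (tlift_linear bA)) !(apply_tlift lF) => e.
transitivity (tlift (fun u y => tlift F (u \ot comul H y)) (comul H h)).
  rewrite -[RHS]e; apply: eq_tlift => x z.
  rewrite tlift_tens // (apply_tlift lF).
  by apply: eq_tlift => u v; rewrite tlift_tens // /F tlift_tens.
by apply: eq_tlift => u y; rewrite tlift_tens.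
Qed.

Lemma sweedler2_linear (K : fieldType) (H : hopfAlgebra K) (X : lmodType K)
    (E : H -> H -> X) :
  bilin E -> linear (fun h => sweedler2 h E).
Proof. by move=> bE; apply: linear_comp (tlift_linear bE) (linearP _). Qed.

(** * Convolution and its action on [tensor G H] *)

Section ConvolutionAction.
Variables (K : fieldType) (H : hopfAlgebra K) (G : lmodType K).
(** The product is a parameter, to be instantiated by the products of [B] and [Gamma(B)] and by
    their opposites. *)
Variables (m : G -> G -> G) (e : G).
Hypotheses (m_bilin : bilin m) (mA : associative m).
Hypotheses (m1x : left_id e m) (mx1 : right_id e m).

Definition conv (f g : H -> G) (h : H) : G :=
  sweedler2 h (fun x y => m (f x) (g y)).

Definition conv_act (f : H -> G) : tensor G H -> tensor G H :=
  tlift (fun g (h : H) => sweedler2 h (fun h1 h2 => m g (f h1) \ot h2)).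

Lemma conv_linear f g : linear f -> linear g -> linear (conv f g).
Proof.
move=> lf lg; apply: sweedler2_linear; split=> [y|x].
  exact: linear_comp (m_bilin.1 _) lf.
exact: linear_comp (m_bilin.2 _) lg.
Qed.

Lemma bilin_conv_act f : linear f ->
  bilin (fun g (h : H) => sweedler2 h (fun h1 h2 => m g (f h1) \ot h2)).
Proof.
move=> lf; split=> [h|g].
  by apply: linear_tliftl => v w; apply: linear_comp (tens_linearl _) (m_bilin.1 _).
apply: sweedler2_linear; split=> [w|v]; last exact: tens_linearr.
exact: linear_comp (tens_linearl _) (linear_comp (m_bilin.2 _) lf).
Qed.

Lemma conv_act_linear f : linear f -> linear (conv_act f).
Proof. by move=> lf; apply/tlift_linear/bilin_conv_act. Qed.

Lemma conv_act_tens f : linear f -> forall g h,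
  conv_act f (g \ot h) = sweedler2 h (fun h1 h2 => m g (f h1) \ot h2).
Proof. by move=> lf g h; apply/tlift_tens/bilin_conv_act. Qed.

Lemma conv_actD f f' g h : linear f -> linear f' ->
  conv_act (fun x => f x + f' x) (g \ot h) =
  conv_act f (g \ot h) + conv_act f' (g \ot h).
Proof.
move=> lf lf'; rewrite !conv_act_tens //; last exact: linear_add.
rewrite /sweedler2 -tliftD; apply: eq_tlift => x y.
by rewrite (linear_funD (m_bilin.2 _)) (linear_funD (tens_linearl _)).
Qed.

Lemma conv_act_comp f f' g h : linear f -> linear f' ->
  conv_act f' (conv_act f (g \ot h)) = conv_act (conv f f') (g \ot h).
Proof.
move=> lf lf'; rewrite !conv_act_tens //; last exact: conv_linear.
rewrite /sweedler2 (apply_tlift (conv_act_linear lf')).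
(* Both sides are the sum of [g f(h_1) f'(h_2) (x) h_3]; acting twice splits the second tensor
   factor, while [conv f f'] splits the first. *)
transitivity
  (sweedler2 h (fun u y => sweedler2 y (fun v z => m (m g (f u)) (f' v) \ot z))).
  by apply: eq_tlift => x y; rewrite conv_act_tens.
rewrite -sweedler_coassoc; first last.
- by move=> u v; apply: tens_linearr.
- by move=> u w; apply: linear_comp (tens_linearl _) (linear_comp (m_bilin.2 _) lf').
- move=> v w; apply: linear_comp (tens_linearl _) _.
  exact: linear_comp (m_bilin.1 _) (linear_comp (m_bilin.2 _) lf).
apply: eq_tlift => x z.
rewrite (apply_tlift (linear_comp (tens_linearl z) (m_bilin.2 g))).
by apply: eq_tlift => u v; rewrite mA.
Qed.

Lemma conv_act_counit f g h : (forall x, f x = counit H x *: e) ->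
  conv_act f (g \ot h) = g \ot h.
Proof.
move=> fE; have lf : linear f by move=> k x y; rewrite !fE linearP scalerDl scalerA.
rewrite conv_act_tens // -[in RHS](counitl h) (apply_tlift (tens_linearr g)).
apply: eq_tlift => x y; rewrite fE (linear_funZ (m_bilin.2 _)) mx1.
by rewrite (linear_funZ (tens_linearl _)) (linear_funZ (tens_linearr _)).
Qed.

(* Apply [id (x) counit] to the hypothesis. *)
Lemma conv_act_fix_counit f : linear f ->
  (forall h, conv_act f (e \ot h) = e \ot h) ->
  forall h, f h = counit H h *: e.
Proof.
move=> lf fixf h; pose eps (g : G) (y : H) : G := (counit H y : K) *: g.
have beps : bilin eps.
  split=> [w|v] k x y; first by rewrite /eps scalerDr !scalerA mulrC.
  by rewrite /eps linearP scalerDl scalerA.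
have := congr1 (tlift eps) (fixf h); rewrite conv_act_tens // (tlift_tens _ _ beps) => epsE.
rewrite -[RHS]/(eps e h) -epsE.
rewrite /sweedler2 (apply_tlift (tlift_linear beps)) -[in LHS](counitr h).
rewrite (apply_tlift lf); apply: eq_tlift => x y.
by rewrite tlift_tens // m1x (linear_funZ lf).
Qed.

(** * Conjugating a covariant derivative by a convolution-invertible map *)

Section Conjugation.
(** [S] models the degree-0 forms, on which [d] obeys a Leibniz rule without sign. *)
Variables (S : G -> Prop) (d : {linear G -> G}).
Hypotheses (S1 : S e) (SM : forall x y, S x -> S y -> S (m x y)).
Hypothesis dM : forall x y, S x -> S y -> d (m x y) = m (d x) y + m x (d y).
Variables (D : {linear tensor G H -> tensor G H}) (A : {linear H -> G}).
Hypothesis DE : forall x h, S x -> D (x \ot h) = d x \ot h - conv_act A (x \ot h).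
Variables t tV : {linear H -> G}.
Hypotheses (St : forall h, S (t h)) (StV : forall h, S (tV h)).
Hypothesis tVt : forall h, conv tV t h = counit H h *: e.

Lemma deriv_conv_inverse h : conv (d \o tV) t h + conv tV (d \o t) h = 0.
Proof.
have d1 : d e = 0.
  (* Leibniz on [e = m e e] gives [d e = d e + d e]. *)
  apply: (@addrI _ (d e)); rewrite addr0.
  by rewrite -[in RHS](m1x e) dM // m1x mx1.
rewrite -tliftD; transitivity (d (conv tV t h)).
  by rewrite (apply_tlift (linearP d)); apply: eq_tlift => x y; rewrite dM.
by rewrite tVt linearZ /= d1 scaler0.
Qed.

Lemma gauge_conjugation x h : S x ->
  conv_act t (D (conv_act tV (x \ot h))) =
  d x \ot h -
  conv_act (fun y => conv (conv tV A) t y + conv tV (d \o t) y) (x \ot h).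
Proof.
move=> Sx; have lA : linear A := linearP A.
have [lt ltV] : linear t /\ linear tV by split; apply: linearP.
have [ldt ldtV] : linear (d \o t) /\ linear (d \o tV).
  by split; apply: linearP.
(* The elements [m x (tV u)] stay in [S], so [DE] applies termwise and Leibniz splits
   [d (m x (tV u))] into the first two terms. *)
have -> : D (conv_act tV (x \ot h)) =
    conv_act tV (d x \ot h) + conv_act (d \o tV) (x \ot h)
    - conv_act A (conv_act tV (x \ot h)).
  rewrite !conv_act_tens // /sweedler2 (apply_tlift (linearP D)).
  rewrite (apply_tlift (conv_act_linear lA)) -tliftD -tliftB.
  apply: eq_tlift => u y; rewrite DE; last exact: SM.
  by rewrite dM // (linear_funD (tens_linearl _)).
have lct := conv_act_linear lt.
rewrite (linear_funB lct) (linear_funD lct) !conv_act_comp //; last first.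
  exact: conv_linear.
rewrite (conv_act_counit _ _ tVt) conv_actD; try by do ?apply: conv_linear.
(* Once the [A] terms and [d x \ot h] cancel, the actions of [conv (d \o tV) t] and
   [conv tV (d \o t)] must add up to zero, which is [deriv_conv_inverse]. *)
rewrite opprD addrA addrAC; congr (_ - _); apply/eqP.
rewrite eq_sym subr_eq -addrA -subr_eq0 opprD addNKr oppr_eq0 -conv_actD.
- rewrite -/(conv _ _) conv_act_tens; last by apply: linear_add; apply: conv_linear.
  apply/eqP/big1 => p _; rewrite deriv_conv_inverse.
  by rewrite (linear_fun0 (m_bilin.2 _)) (linear_fun0 (tens_linearl _)).
- exact: conv_linear.
- exact: conv_linear.
Qed.

End Conjugation.
End ConvolutionAction.

Section MulOp.
Variables (K : fieldType) (A : algType K).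

(** With this product a right gauge transformation, which multiplies by [tau] on the left, becomes a
    [conv_act]. *)
Definition mulop (x y : A) : A := y * x.

Lemma bilin_mul : bilin (@GRing.mul A).
Proof.
by split=> [w|v] k x y; [rewrite mulrDl scalerAl | rewrite mulrDr scalerAr].
Qed.

Lemma bilin_mulop : bilin mulop.
Proof. by split; [apply: bilin_mul.2 | apply: bilin_mul.1]. Qed.

Lemma mulopA : associative mulop.
Proof. by move=> x y z; rewrite /mulop mulrA. Qed.

End MulOp.

(** * Specialisation to gauge transformations and horizontal forms *)

Section Bundle.
Variables (K : fieldType) (B : algType K) (H : hopfAlgebra K).
Variable GB : diffAlgebra B.

Definition degree0 (x : GB) : Prop := exists b, x = incl GB b.

Lemma degree0M x y : degree0 x -> degree0 y -> degree0 (x * y).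
Proof. by move=> [a ->] [b ->]; exists (a * b); rewrite rmorphM. Qed.

Lemma degree0_1 : degree0 1.
Proof. by exists 1; rewrite rmorph1. Qed.

Lemma degree0_comp (f : H -> B) h : degree0 ((incl GB \o f) h).
Proof. by exists (f h). Qed.

Lemma dform_degree0M x y : degree0 x -> dform (x * y) = dform x * y + x * dform y.
Proof. by move=> x0; rewrite (dformM (n := 0)) ?expr0 ?mul1r //; apply/form_deg0. Qed.

Section Counit.
Variables (m : B -> B -> B) (mG : GB -> GB -> GB).
Hypotheses (m_bilin : bilin m) (mA : associative m).
Hypothesis m1x : left_id 1 m.
Hypothesis incl_m : forall x y, incl GB (m x y) = mG (incl GB x) (incl GB y).
Variables (alpha alphaV : {linear tensor B H -> tensor B H}).
Variables (tau tauV : {linear H -> B}).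
Hypothesis alphaVK : cancel alphaV alpha.
Hypothesis alphaE : forall a h, alpha (a \ot h) = conv_act m tau (a \ot h).
Hypothesis alphaVE : forall a h, alphaV (a \ot h) = conv_act m tauV (a \ot h).

(** Since [alpha \o alphaV] is the identity, the action of [conv m tauV tau] fixes every [1 \ot g],
    so [conv_act_fix_counit] identifies it with the counit; [incl GB] carries this to forms. *)
Lemma gauge_conv_counit h :
  conv mG (incl GB \o tauV) (incl GB \o tau) h = counit H h *: 1.
Proof.
have [lt ltV] : linear tau /\ linear tauV by split; apply: linearP.
transitivity (incl GB (conv m tauV tau h)).
  by rewrite (apply_tlift (linearP (incl GB))); apply: eq_tlift => x y; rewrite /= incl_m.
rewrite (conv_act_fix_counit (m := m) (e := 1)) ?linearZ ?rmorph1 //.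
  exact: conv_linear.
move=> g; rewrite -(conv_act_comp m_bilin mA) //.
rewrite -[RHS]alphaVK alphaVE [in RHS]conv_act_tens // /sweedler2.
rewrite (apply_tlift (linearP alpha)) conv_act_tens //.
rewrite (apply_tlift (conv_act_linear m_bilin lt)).
by apply: eq_tlift => x y; rewrite alphaE.
Qed.

End Counit.

Section Transport.
Variable mG : GB -> GB -> GB.
Hypotheses (m_bilin : bilin mG) (mA : associative mG).
Hypotheses (m1x : left_id 1 mG) (mx1 : right_id 1 mG).
Hypothesis mM : forall x y, degree0 x -> degree0 y -> degree0 (mG x y).
Hypothesis dM : forall x y, degree0 x -> degree0 y ->
  dform (mG x y) = mG (dform x) y + mG x (dform y).

Lemma gauge_derivative (D : {linear hor H GB -> hor H GB})
    (A : {linear H -> GB}) (tau tauV : {linear H -> B}) (a : B) (h : H) :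
  (forall b g, D (incl GB b \ot g) =
     dform (incl GB b) \ot g - conv_act mG A (incl GB b \ot g)) ->
  (forall g, conv mG (incl GB \o tauV) (incl GB \o tau) g = counit H g *: 1) ->
  conv_act mG (incl GB \o tau)
    (D (conv_act mG (incl GB \o tauV) (incl GB a \ot h))) =
  dform (incl GB a) \ot h
  - sweedler2 h (fun h1 h2 =>
      mG (incl GB a)
        (sweedler3 h1 (fun x y z =>
           mG (mG (incl GB (tauV x)) (A y)) (incl GB (tau z)))
         + sweedler2 h1 (fun x y =>
             mG (incl GB (tauV x)) (dform (incl GB (tau y))))) \ot h2).
Proof.
move=> DE tVt.
have DE' x g : degree0 x -> D (x \ot g) = dform x \ot g - conv_act mG A (x \ot g).
  by case=> b ->.
rewrite (gauge_conjugation m_bilin mA m1x mx1 degree0_1 mM dM DE'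
  (degree0_comp tau) (degree0_comp tauV) tVt); last by exists a.
have lA : linear A := linearP A.
have lt : linear (incl GB \o tau) by apply: linearP.
have ltV : linear (incl GB \o tauV) by apply: linearP.
have ldt : linear (dform \o (incl GB \o tau)) by apply: linearP.
rewrite conv_act_tens //; last by apply: linear_add; do ?apply: conv_linear.
congr (_ - _); apply: eq_tlift => x y; congr (mG _ (_ + _) \ot _).
apply: eq_tlift => u v; rewrite [in LHS]/conv /sweedler2.
(* The last factor moves inside the inner sum, turning the nested convolution into [sweedler3]. *)
exact: (apply_tlift (g := fun w => mG w _) (m_bilin.1 _)).
Qed.

End Transport.
End Bundle.

Theorem mainTheorem9 (R : realType) (B : algType R[i]) (H : hopfAlgebra R[i])
  (S_bij : bijective (antipode H))
  (GB : diffAlgebra B) (GH : diffAlgebra H) (GH_cov : right_covariant GH) :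
  (forall (D : {linear hor H GB -> hor H GB}) (A : {linear H -> GB})
     (alpha alphaV : {linear tensor B H -> tensor B H})
     (tau tauV : {linear H -> B}),
   left_cov_derivative D A ->
   left_gauge alpha -> cancel alpha alphaV -> cancel alphaV alpha ->
   left_gauge_map alpha tau -> left_gauge_map alphaV tauV ->
   let D' := left_gauge_hor (GB := GB) tau \o D \o left_gauge_hor tauV in
   let A' (h : H) : GB :=
     sweedler3 h (fun h1 h2 h3 =>
       incl GB (tauV h1) * A h2 * incl GB (tau h3))
     + sweedler2 h (fun h1 h2 =>
         incl GB (tauV h1) * dform (incl GB (tau h2))) in
   forall (a : B) (h : H),
     D' (incl GB a \ot h) =
       dform (incl GB a) \ot h
       - sweedler2 h (fun h1 h2 => (incl GB a * A' h1) \ot h2))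
  /\
  (forall (D : {linear hor H GB -> hor H GB}) (A : {linear H -> GB})
     (alpha alphaV : {linear tensor B H -> tensor B H})
     (tau tauV : {linear H -> B}),
   right_cov_derivative D A ->
   right_gauge alpha -> cancel alpha alphaV -> cancel alphaV alpha ->
   right_gauge_map alpha tau -> right_gauge_map alphaV tauV ->
   let D' := right_gauge_hor (GB := GB) tau \o D \o right_gauge_hor tauV in
   let A' (h : H) : GB :=
     sweedler3 h (fun h1 h2 h3 =>
       incl GB (tau h3) * A h2 * incl GB (tauV h1))
     - sweedler2 h (fun h1 h2 =>
         incl GB (tau h2) * dform (incl GB (tauV h1))) in
   forall (a : B) (h : H),
     D' (incl GB a \ot h) =
       dform (incl GB a) \ot h
       - sweedler2 h (fun h1 h2 => (A' h1 * incl GB a) \ot h2)).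
Proof.
split=> D A alpha alphaV tau tauV [_ _ DE] _ _ alphaVK tauE tauVE D' A' a h.
  have bB := bilin_mul B; have bG := bilin_mul GB.
  (* [left_gauge_hor tau] is convertible to [conv_act] of [incl GB \o tau] for the ordinary
     product. *)
  apply: (gauge_derivative bG (@mulrA _) (@mul1r _) (@mulr1 _)).
  - exact: degree0M.
  - by move=> x y x0 _; apply: dform_degree0M.
  - move=> b g; rewrite (DE 0); last by apply/form_deg0; exists b.
    by rewrite expr0 scale1r conv_act_tens //; apply: linearP.
  - apply: (gauge_conv_counit bB (@mulrA _) (@mul1r _) _ alphaVK).
    + exact: rmorphM.
    + by move=> b g; rewrite tauE conv_act_tens //; apply: linearP.
    + by move=> b g; rewrite tauVE conv_act_tens //; apply: linearP.
(* Right case: opposite products throughout, so [mulr1] and [mul1r] exchange roles as unit laws. *)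
have bB := bilin_mulop B; have bG := bilin_mulop GB.
have tVt := gauge_conv_counit (mG := mulop (A := GB)) bB (@mulopA _ _) (@mulr1 _)
  (fun x y => rmorphM (incl GB) y x) alphaVK.
have {}tVt g : conv (mulop (A := GB)) (incl GB \o tauV) (incl GB \o tau) g = counit H g *: 1.
  apply: tVt => b k; first by rewrite tauE conv_act_tens //; apply: linearP.
  by rewrite tauVE conv_act_tens //; apply: linearP.
have MopS (x y : GB) : degree0 x -> degree0 y -> degree0 (mulop x y).
  by move=> x0 y0; apply: degree0M.
have dMop (x y : GB) : degree0 x -> degree0 y ->
    dform (mulop x y) = mulop (dform x) y + mulop x (dform y).
  by move=> x0 y0; rewrite /mulop dform_degree0M // addrC.
have DE' b g : D (incl GB b \ot g) =
    dform (incl GB b) \ot g - conv_act (mulop (A := GB)) A (incl GB b \ot g).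
  by rewrite DE conv_act_tens //; apply: linearP.
rewrite [LHS](gauge_derivative bG (@mulopA _ _) (@mulr1 _) (@mul1r _) MopS dMop _ _ DE' tVt).
congr (_ - _); apply: eq_tlift => x y; congr (_ \ot _); congr (_ * _); congr (_ + _).
  by apply: eq_tlift => u z; apply: eq_tlift => v w; apply: mulrA.
(* The opposite product yields [d tau(h_2) tauV(h_1)]; differentiating the inverse relation trades
   it for [- tau(h_2) d tauV(h_1)]. *)
apply/eqP; rewrite -addr_eq0 addrC; apply/eqP.
exact: (deriv_conv_inverse (@mulr1 _) (@mul1r _) (degree0_1 _) dMop
  (degree0_comp _ tau) (degree0_comp _ tauV) tVt x).
Qed.
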